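(* Let $G^0\in\mathcal{S}_G$. Let $\mu_0>0$ be a projected gradient dominance constant of $J$ over $\mathcal{S}_G(J(G^0))$ and let $l_0>0$ be a smoothness constant of $J$ over $\mathcal{S}_G(J(G^0))$ (both notions defined in the context). Let $\eta\in(0,1/l_0]$ and define the iterates $$G^{k+1}=G^k-\eta\,\Pi_{X_-}\nabla J(G^k),\qquad k=0,1,2,\dots$$ Then $G^k\in\mathcal{S}_G(J(G^0))$ for all $k\in\mathbb{N}$. Moreover, for any $\epsilon>0$ and any $$k\ge \frac{2\mu_0^2}{\epsilon(2\eta-l_0\eta^2)},$$ it holds that $J(G^k)-J^*\le\epsilon$.
   Context: Setting. Let $A\in\mathbb{R}^{n\times n}$, $B\in\mathbb{R}^{n\times m}$ with $(A,B)$ controllable, and let $Q\in\mathbb{R}^{n\times n}$, $R\in\mathbb{R}^{m\times m}$ be symmetric positive definite. Let $X_-\in\mathbb{R}^{n\times T}$, $U_-\in\mathbb{R}^{m\times T}$, $X_+\in\mathbb{R}^{n\times T}$ be data matrices satisfying $X_+=AX_-+BU_-$, and assume that $D_-=\begin{bmatrix}U_- \\ X_-\end{bmatrix}\in\mathbb{R}^{(m+n)\times T}$ has full row rank $m+n$. For $G\in\mathbb{R}^{T\times n}$ with spectral radius $\rho(X_+G)<1$, let $\Sigma_G$ be the unique solution of $\Sigma_G=I_n+X_+G\Sigma_GG^\top X_+^\top$ and define $$J(G)=\mathrm{Tr}\{(Q+G^\top U_-^\top RU_-G)\Sigma_G\}.$$ (This is the expected LQR cost $\mathbb{E}\sum_{t\ge0}(x(t)^\top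 Qx(t)+u(t)^\top Ru(t))$ for $x(t+1)=X_+Gx(t)$, $u(t)=U_-Gx(t)$, with $\mathbb{E}[x(0)]=0$, $\mathbb{E}[x(0)x(0)^\top]=I_n$.) The gradient $\nabla J(G)\in\mathbb{R}^{T\times n}$ and second derivative $\nabla^2J(G)[Z,Z]=\frac{d^2}{dt^2}J(G+tZ)|_{t=0}$, $Z\in\mathbb{R}^{T\times n}$, are those of $J$ as a function on the open set $\{G\in\mathbb{R}^{T\times n}:\rho(X_+G)<1\}$. Feasible set: $\mathcal{S}_G=\{G\in\mathbb{R}^{T\times n}: X_-G=I_n,\ \rho(X_+G)<1\}$. Sublevel sets: $\mathcal{S}_G(a)=\{G\in\mathcal{S}_G: J(G)\le a\}$. $J^*=\min_{G\in\mathcal{S}_G}J(G)$. Projection: $\Pi_{X_-}=I_T-X_-^\dagger X_-$ with $X_-^\dagger=X_-^\top(X_-X_-^\top)^{-1}$, the orthogonal projection onto the nullspace of $X_-$. $\|\cdot\|$ denotes the spectral norm (2-norm) of a matrix and $\|\cdot\|_F$ the Frobenius norm. Constants. $\mu_0>0$ is a projected gradient dominance constant of $J$ over $\mathcal{S}_G(a)$ if $J(G)-J^*\le\mu_0\|\Pi_{X_-}\nabla J(G)\|$ for all $G\in\mathcal{S}_G(a)$. $l_0>0$ is a smoothness constant of $J$ over $\mathcal{S}_G(a)$ if $\|\nabla^2J(G)\|:=\sup_{\|Z\|_F=1}|\nabla^2J(G)[Z,Z]|\le l_0$ for all $G\in\mathcal{S}_G(a)$. *)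

(* Defs.v *)
From mathcomp Require Import all_boot all_order all_algebra.
From mathcomp Require Import complex.
From mathcomp Require Import all_classical all_reals all_analysis.

Set Implicit Arguments.
Unset Strict Implicit.
Unset Printing Implicit Defensive.

Import Order.TTheory GRing.Theory Num.Theory.
Import numFieldNormedType.Exports.

Local Open Scope classical_set_scope.
Local Open Scope ring_scope.

(* The library norm [`|M|] on matrices is the entrywise maximum, so the
   Frobenius and spectral norms are introduced separately. *)
Definition frobenius_norm (R : realType) (p q : nat) (M : 'M[R]_(p, q)) : R :=
  Num.sqrt (\sum_(i < p) \sum_(j < q) M i j ^+ 2).

(* On column vectors [frobenius_norm] is the Euclidean norm. *)
Definition spectral_norm (R : realType) (p q : nat) (M : 'M[R]_(p, q)) : R :=
  sup [set frobenius_norm (M *m x) | x in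
        [set x : 'cV[R]_q | frobenius_norm x = 1]].

(* The eigenvalues are the complex ones: [M] is first mapped into [R[i]]. *)
Definition spectral_radius (R : realType) (n : nat) (M : 'M[R]_n) : R :=
  sup [set Normc.normc z | z in
        [set z : R[i] | eigenvalue (map_mx (real_complex R) M) z]].

Definition sym_posdef (R : realType) (n : nat) (M : 'M[R]_n) : Prop :=
  M^T = M /\ forall x : 'cV[R]_n, x != 0 -> 0 < (x^T *m M *m x) 0 0.

(* Kalman rank condition on [B, A B, ..., A^(n-1) B]. *)
Definition controllable (R : realType) (n m : nat)
    (A : 'M[R]_n) (B : 'M[R]_(n, m)) : Prop :=
  \rank (\mxrow_(i < n) (A ^+ i *m B)) = n.

Section lqr_data.
Variables (R : realType) (n m T : nat).
Variables (Q : 'M[R]_n) (Rw : 'M[R]_m).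
Variables (Xm : 'M[R]_(n, T)) (Um : 'M[R]_(m, T)) (Xp : 'M[R]_(n, T)).

(* A solution of the Lyapunov equation; it is the unique one as soon as
   [spectral_radius (Xp *m G) < 1], and irrelevant otherwise. *)
Definition Sigma (G : 'M[R]_(T, n)) : 'M[R]_n :=
  xget 0 [set S | S = 1%:M + Xp *m G *m S *m G^T *m Xp^T].

Definition J (G : 'M[R]_(T, n)) : R :=
  \tr ((Q + G^T *m Um^T *m Rw *m Um *m G) *m Sigma G).

(* [J] is total, but the derivatives below at a point of the open set
   [spectral_radius (Xp *m G) < 1] only depend on its values there. *)
Definition gradJ (G : 'M[R]_(T, n)) : 'M[R]_(T, n) :=
  \matrix_(i < T, j < n) ('D_(delta_mx i j) J G).

Definition hessJ (G Z : 'M[R]_(T, n)) : R :=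
  derive1n 2 (fun t : R => J (G + t *: Z)) 0.

(* Valued in [\bar R], so that an unbounded Hessian has norm [+oo]. *)
Definition hessJ_norm (G : 'M[R]_(T, n)) : \bar R :=
  ereal_sup [set `|hessJ G Z|%:E | Z in
              [set Z : 'M[R]_(T, n) | frobenius_norm Z = 1]].

Definition feasible : set 'M[R]_(T, n) :=
  [set G | Xm *m G = 1%:M /\ spectral_radius (Xp *m G) < 1].

Definition sublevel (a : R) : set 'M[R]_(T, n) :=
  [set G | feasible G /\ J G <= a].

(* The infimum of [J] over the feasible set, hence the minimum when attained. *)
Definition Jstar : R := inf [set J G | G in feasible].

(* Orthogonal projection onto the nullspace of [Xm] when [Xm] has full row
   rank, so that [Xm *m Xm^T] is invertible. *)
Definition proj_null : 'M[R]_T :=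
  1%:M - Xm^T *m invmx (Xm *m Xm^T) *m Xm.

Definition gradient_dominance_constant (a mu : R) : Prop :=
  0 < mu /\ forall G, sublevel a G ->
    J G - Jstar <= mu * spectral_norm (proj_null *m gradJ G).

Definition smoothness_constant (a l : R) : Prop :=
  0 < l /\ forall G, sublevel a G -> (hessJ_norm G <= l%:E)%E.

End lqr_data.

(* Main.v *)
(** A stable [G] is characterised by its Lyapunov equation: [rho(Xp G) < 1] iff
    some positive semidefinite [S] solves [S = I + M S M^T] with [M = Xp G], and
    then [|x M^k|^2 <= c (1 - 1/c)^k |x|^2] as soon as [S <= c I]. Since
    [Tr Sigma_G] is bounded on a sublevel set of [J], this decay bound is uniform
    there and passes to limits; conversely [Sigma_G], a rational function of [G],
    stays positive near a stable [G]. So along the segment from [G^k] to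
    [G^(k+1)] the set of points of the sublevel set is both closed and relatively
    open (openness because the second-order bound keeps [J] strictly decreasing),
    and the segment never leaves it. The descent inequality on the segment
    and gradient dominance give
    [delta_(k+1) <= delta_k - (eta - l0 eta^2 / 2) (delta_k / mu0)^2]
    for [delta_k = J(G^k) - J^*], whence
    [1 / delta_k >= k (eta - l0 eta^2 / 2) / mu0^2]. *)

Require Import Defs.
From mathcomp Require Import all_boot all_order all_algebra.
From mathcomp Require Import complex.
From mathcomp Require Import all_classical all_reals all_analysis.
From mathcomp Require Import ring lra.
Import Order.TTheory GRing.Theory Num.Theory.
Import numFieldNormedType.Exports.
Local Open Scope classical_set_scope.
Local Open Scope ring_scope.

Set Implicit Arguments.
Unset Strict Implicit.
Unset Printing Implicit Defensive.

(** * Quadratic forms *)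

Section QuadraticForm.
Variable R : realFieldType.

(** Row vectors are used because eigenvectors act from the left: conjugating [S] by [M] becomes
    evaluation at [x *m M], so powers of [M] accumulate on the right. *)
Definition bform (n : nat) (S : 'M[R]_n) (x y : 'rV[R]_n) : R :=
  (x *m S *m y^T) 0 0.

Definition sqnorm (n : nat) (x : 'rV[R]_n) : R := bform 1%:M x x.

Lemma bformDl n (S : 'M[R]_n) x1 x2 y :
  bform S (x1 + x2) y = bform S x1 y + bform S x2 y.
Proof. by rewrite /bform !mulmxDl mxE. Qed.

Lemma bformDr n (S : 'M[R]_n) x y1 y2 :
  bform S x (y1 + y2) = bform S x y1 + bform S x y2.
Proof. by rewrite /bform linearD mulmxDr mxE. Qed.

Lemma bformZl n (S : 'M[R]_n) a x y : bform S (a *: x) y = a * bform S x y.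
Proof. by rewrite /bform -!scalemxAl mxE. Qed.

Lemma bformZr n (S : 'M[R]_n) a x y : bform S x (a *: y) = a * bform S x y.
Proof. by rewrite /bform linearZ -scalemxAr mxE. Qed.

Lemma bformDm n (S1 S2 : 'M[R]_n) x y :
  bform (S1 + S2) x y = bform S1 x y + bform S2 x y.
Proof. by rewrite /bform mulmxDr mulmxDl mxE. Qed.

Lemma bformBm n (S1 S2 : 'M[R]_n) x y :
  bform (S1 - S2) x y = bform S1 x y - bform S2 x y.
Proof. by rewrite /bform mulmxBr mulmxBl mxE [X in _ + X]mxE. Qed.

Lemma bform_conj n p (M : 'M[R]_(n, p)) (S : 'M[R]_p) x y :
  bform (M *m S *m M^T) x y = bform S (x *m M) (y *m M).
Proof. by rewrite /bform trmx_mul !mulmxA. Qed.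

Lemma bformE n (S : 'M[R]_n) x y :
  bform S x y = \sum_i \sum_j x 0 i * S i j * y 0 j.
Proof.
rewrite /bform mxE exchange_big /=; apply: eq_bigr => j _.
by rewrite mxE mulr_suml; apply: eq_bigr => i _; rewrite mxE.
Qed.

Lemma sqnormE n (x : 'rV[R]_n) : sqnorm x = \sum_i x 0 i ^+ 2.
Proof.
rewrite /sqnorm /bform mulmx1 mxE.
by apply: eq_bigr => i _; rewrite mxE expr2.
Qed.

Lemma sqnorm_ge0 n (x : 'rV[R]_n) : 0 <= sqnorm x.
Proof. by rewrite sqnormE; apply: sumr_ge0 => i _; apply: sqr_ge0. Qed.

Lemma sqnorm_eq0 n (x : 'rV[R]_n) : (sqnorm x == 0) = (x == 0).
Proof.
apply/eqP/eqP => [|->]; last first.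
  by rewrite sqnormE big1 // => i _; rewrite mxE expr0n.
rewrite sqnormE => /eqP; rewrite psumr_eq0; last by move=> i _; apply: sqr_ge0.
move/allP => h; apply/rowP => i; rewrite mxE; apply/eqP.
by have := h i (mem_index_enum _); rewrite /= sqrf_eq0.
Qed.

Lemma sqnorm_gt0 n (x : 'rV[R]_n) : (0 < sqnorm x) = (x != 0).
Proof. by rewrite lt_neqAle sqnorm_ge0 andbT eq_sym sqnorm_eq0. Qed.

Lemma ler_entry_sqnorm n (x : 'rV[R]_n) i : x 0 i ^+ 2 <= sqnorm x.
Proof.
rewrite sqnormE (bigD1 i) //= lerDl.
by apply: sumr_ge0 => j _; apply: sqr_ge0.
Qed.

(** Each product obeys [|x_i x_j| <= (x_i^2 + x_j^2) / 2 <= sqnorm x]. The crude entrywise constant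
    is enough: it serves only as some finite bound, or as one that is small when the entries are. *)
Lemma ler_bform n (S : 'M[R]_n) x :
  `|bform S x x| <= (\sum_i \sum_j `|S i j|) * sqnorm x.
Proof.
rewrite bformE mulr_suml; apply: le_trans (ler_norm_sum _ _ _) _.
apply: ler_sum => i _; rewrite mulr_suml.
apply: le_trans (ler_norm_sum _ _ _) _; apply: ler_sum => j _.
rewrite mulrAC normrM mulrC ler_wpM2l // normrM.
have n2 (a : R) : `|a| ^+ 2 = a ^+ 2 by rewrite real_normK ?num_real.
have h1 := ler_entry_sqnorm x i; have h2 := ler_entry_sqnorm x j.
have := sqr_ge0 (`|x 0 i| - `|x 0 j|); rewrite sqrrB !n2; lra.
Qed.

Lemma cauchy_schwarz_bform n (S : 'M[R]_n) x y :
  S^T = S -> (forall z, z != 0 -> 0 < bform S z z) ->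
  bform S x y ^+ 2 <= bform S x x * bform S y y.
Proof.
move=> symS posS.
have [->|y0] := eqVneq y 0.
  have -> : bform S x 0 = 0 by rewrite /bform trmx0 mulmx0 mxE.
  have -> : bform S 0 0 = 0 by rewrite /bform trmx0 mulmx0 mxE.
  by rewrite expr0n /= mulr0.
have py := posS _ y0.
have sym : bform S y x = bform S x y.
  rewrite /bform; set a := x *m S *m y^T.
  have -> : y *m S *m x^T = a^T by rewrite /a !trmx_mul trmxK symS mulmxA.
  by rewrite mxE.
(* With [a], [b], [c] the values at [(x,x)], [(x,y)], [(y,y)], the form at [c x - b y] equals
   [c (a c - b^2)], and [c > 0]. *)
have : 0 <= bform S (bform S y y *: x - bform S x y *: y)
                    (bform S y y *: x - bform S x y *: y).
  have [->|/posS/ltW//] := eqVneq (bform S y y *: x - bform S x y *: y) 0.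
  by rewrite /bform trmx0 mulmx0 mxE.
rewrite -scaleNr !(bformDl, bformDr, bformZl, bformZr) sym.
set a := bform S x x; set b := bform S x y; set c := bform S y y.
rewrite [X in 0 <= X](_ : _ = c * (a * c - b ^+ 2)); last by ring.
by rewrite pmulr_rge0 // subr_ge0.
Qed.

Lemma sqnorm_posdef n (z : 'rV[R]_n) : z != 0 -> 0 < bform 1%:M z z.
Proof. by rewrite -sqnorm_gt0. Qed.

(** Cauchy-Schwarz for [x] and [x S^-1] gives [sqnorm x ^ 2 <= S(x,x) * S^-1(x,x)], and the last
    factor is at most [C * sqnorm x]. No eigenvalue or compactness argument is involved. *)
Lemma posdef_coercive n (S : 'M[R]_n) :
  S^T = S -> (forall z, z != 0 -> 0 < bform S z z) ->
  exists2 c, 0 < c & forall x, c * sqnorm x <= bform S x x.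
Proof.
move=> symS posS.
have uS : S \in unitmx.
  rewrite -row_free_unit; apply/inj_row_free => v vS.
  apply/eqP/negPn/negP => /posS; rewrite /bform vS mul0mx mxE.
  by rewrite ltxx.
(* The added 1 makes [C] positive whatever the entries are. *)
pose C := \sum_i \sum_j `|invmx S i j| + 1.
have C0 : 0 < C.
  rewrite ltr_wpDl //; apply: sumr_ge0 => i _; apply: sumr_ge0 => j _ //.
exists C^-1; rewrite ?invr_gt0 // => x.
have [->|x0] := eqVneq x 0.
  by rewrite /sqnorm /bform trmx0 !mulmx0 mxE mulr0.
have sx : 0 < sqnorm x by rewrite sqnorm_gt0.
have h := cauchy_schwarz_bform x (x *m invmx S) symS posS.
have e1 : bform S x (x *m invmx S) = sqnorm x.
  rewrite /sqnorm /bform trmx_mul trmx_inv symS mulmx1 !mulmxA.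
  by rewrite -(mulmxA x) mulmxV // mulmx1.
have e2 : bform S (x *m invmx S) (x *m invmx S) = bform (invmx S) x x.
  rewrite /bform trmx_mul trmx_inv symS -(mulmxA x) mulVmx // mulmx1.
  by rewrite mulmxA.
have := ler_bform (invmx S) x.
rewrite e1 e2 in h => hi.
have hi2 : bform (invmx S) x x <= C * sqnorm x.
  apply: le_trans (ler_norm _) (le_trans hi _).
  by rewrite ler_pM2r // lerDl.
have h3 : sqnorm x * sqnorm x <= bform S x x * C * sqnorm x.
  rewrite -expr2; apply: le_trans h _; rewrite -mulrA ler_pM2l //.
  exact: posS.
rewrite ler_pM2r // in h3.
by rewrite mulrC ler_pdivrMr.
Qed.

End QuadraticForm.

(** * Entrywise closure properties *)

Section FunctionAlgebra.
Variables (R : comUnitRingType) (V : Type) (P : (V -> R) -> Prop).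
Hypothesis Pcst : forall c, P (fun=> c).
Hypothesis PD : forall f g, P f -> P g -> P (fun x => f x + g x).
Hypothesis PM : forall f g, P f -> P g -> P (fun x => f x * g x).
Hypothesis Pext : forall f g, f =1 g -> P f -> P g.

(** [P] stands for any class of scalar functions closed under the ring operations. It is
    instantiated with convergence along a sequence, differentiability, and polynomials in one
    variable, so determinants and adjugates are traversed only once. *)
Definition entrywise (p q : nat) (F : V -> 'M[R]_(p, q)) :=
  forall i j, P (fun x => F x i j).

Lemma closed_sum (I : Type) (r : seq I) (Q : pred I) (F : I -> V -> R) :
  (forall i, P (F i)) -> P (fun x => \sum_(i <- r | Q i) F i x).
Proof.
move=> PF; elim: r => [|i r IH].
  by apply: (Pext (f := fun=> 0)) => // x; rewrite big_nil.
case Qi: (Q i).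
  by apply: (Pext (f := fun x => F i x + \sum_(i <- r | Q i) F i x)); last exact: PD;
    move=> x; rewrite big_cons Qi.
by apply: Pext IH => x; rewrite big_cons Qi.
Qed.

Lemma closed_prod (I : Type) (r : seq I) (Q : pred I) (F : I -> V -> R) :
  (forall i, P (F i)) -> P (fun x => \prod_(i <- r | Q i) F i x).
Proof.
move=> PF; elim: r => [|i r IH].
  by apply: (Pext (f := fun=> 1)) => // x; rewrite big_nil.
case Qi: (Q i).
  by apply: (Pext (f := fun x => F i x * \prod_(i <- r | Q i) F i x)); last exact: PM;
    move=> x; rewrite big_cons Qi.
by apply: Pext IH => x; rewrite big_cons Qi.
Qed.

Lemma entrywise_cst p q (A : 'M[R]_(p, q)) : entrywise (fun=> A).
Proof. by move=> i j; apply: Pcst. Qed.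

Lemma entrywiseD p q (F G : V -> 'M[R]_(p, q)) :
  entrywise F -> entrywise G -> entrywise (fun x => F x + G x).
Proof.
move=> PF PG i j; apply: Pext (PD (PF i j) (PG i j)) => x.
by rewrite mxE.
Qed.

Lemma entrywiseM p q r (F : V -> 'M[R]_(p, q)) (G : V -> 'M[R]_(q, r)) :
  entrywise F -> entrywise G -> entrywise (fun x => F x *m G x).
Proof.
move=> PF PG i j.
apply: (Pext (f := fun x => \sum_k F x i k * G x k j)).
  by move=> x; rewrite mxE.
by apply: closed_sum => k; apply: PM.
Qed.

Lemma entrywiseB p q (F G : V -> 'M[R]_(p, q)) :
  entrywise F -> entrywise G -> entrywise (fun x => F x - G x).
Proof.
move=> PF PG i j; apply: Pext (PD (PF i j) (PM (Pcst (-1)) (PG i j))) => x.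
by rewrite !mxE mulN1r.
Qed.

Lemma entrywise_tr p q (F : V -> 'M[R]_(p, q)) :
  entrywise F -> entrywise (fun x => (F x)^T).
Proof. by move=> PF i j; apply: Pext (PF j i) => x; rewrite mxE. Qed.

Lemma entrywiseX p (F : V -> 'M[R]_p) k :
  entrywise F -> entrywise (fun x => F x ^+ k).
Proof.
move=> PF; elim: k => [|k IH] i j.
  by apply: Pext (Pcst ((1%:M : 'M[R]_p) i j)) => x; rewrite expr0.
by apply: Pext (entrywiseM PF IH i j) => x; rewrite exprS.
Qed.

Lemma entrywise_mxvec p q (F : V -> 'M[R]_(p, q)) :
  entrywise F -> entrywise (fun x => mxvec (F x)).
Proof.
move=> PF i j; rewrite ord1; case/mxvec_indexP: j => a b.
by apply: Pext (PF a b) => x; rewrite mxvecE.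
Qed.

Lemma entrywise_vec_mx p q (F : V -> 'rV[R]_(p * q)) :
  entrywise F -> entrywise (fun x => vec_mx (F x)).
Proof.
by move=> PF i j; apply: Pext (PF 0 (mxvec_index i j)) => x; rewrite mxE.
Qed.

Lemma entrywise_lin_mulmx p q r (F : V -> 'M[R]_(p, q)) :
  entrywise F -> entrywise (fun x => lin_mulmx (F x) : 'M[R]_(q * r, p * r)).
Proof.
move=> PF i j.
(* Row [i] of the matrix of a linear map is the vectorised image of the [i]-th basis matrix. *)
pose E := vec_mx (delta_mx 0 i) : 'M[R]_(q, r).
apply: Pext (entrywise_mxvec (entrywiseM PF (entrywise_cst E)) 0 j) => x.
by rewrite [RHS]mxE.
Qed.

Lemma entrywise_lin_mulmxr p q r (F : V -> 'M[R]_(q, r)) :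
  entrywise F -> entrywise (fun x => lin_mulmxr (F x) : 'M[R]_(p * q, p * r)).
Proof.
move=> PF i j.
pose E := vec_mx (delta_mx 0 i) : 'M[R]_(p, q).
apply: Pext (entrywise_mxvec (entrywiseM (entrywise_cst E) PF) 0 j) => x.
by rewrite [RHS]mxE.
Qed.

Lemma closed_det p (F : V -> 'M[R]_p) :
  entrywise F -> P (fun x => \det (F x)).
Proof.
move=> PF; apply: closed_sum => s; apply: PM => //.
exact: closed_prod.
Qed.

Lemma entrywise_adj p (F : V -> 'M[R]_p) :
  entrywise F -> entrywise (fun x => \adj (F x)).
Proof.
move=> PF i j.
apply: (Pext (f := fun x => (-1) ^+ (j + i) * \det (row' j (col' i (F x))))).
  by move=> x; rewrite mxE.
apply: PM => //; apply: closed_det => a b.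
by apply: Pext (PF (lift j a) (lift i b)) => x; rewrite !mxE.
Qed.

Lemma closed_trace p (F : V -> 'M[R]_p) :
  entrywise F -> P (fun x => \tr (F x)).
Proof. by move=> PF; apply: closed_sum => i. Qed.

End FunctionAlgebra.

(** * Spectral radius and powers *)

Section SpectralRadius.
Variable R : realType.
Implicit Types (n : nat) (z : R[i]).
Local Notation normc := (@Normc.normc R).
Local Notation cplx := (map_mx (real_complex R)).

Lemma normc_sqr z : normc z ^+ 2 = complex.Re z ^+ 2 + complex.Im z ^+ 2.
Proof. by case: z => a b /=; rewrite sqr_sqrtr // addr_ge0 ?sqr_ge0. Qed.

Lemma normc_ge0 z : 0 <= normc z.
Proof. by case: z => a b /=; rewrite sqrtr_ge0. Qed.

Lemma normcX z k : normc (z ^+ k) = normc z ^+ k.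
Proof.
elim: k => [|k IH]; first by rewrite !expr0 Normc.normc1.
by rewrite !exprS Normc.normcM IH.
Qed.

Lemma normc_real (x : R) : normc (real_complex R x) = `|x|.
Proof. by rewrite /= expr0n addr0 sqrtr_sqr. Qed.

Lemma eigenvalue_seq n (M : 'M[R[i]]_n) :
  exists s : seq R[i], forall z, eigenvalue M z = (z \in s).
Proof.
have [s Es] := closed_field_poly_normal (char_poly M).
exists s => z; rewrite eigenvalue_root_char Es.
by rewrite (monicP (char_poly_monic M)) scale1r root_prod_XsubC.
Qed.

(** The spectrum is finite, so the supremum is bounded by a maximum over a list, and strict bounds
    on the eigenvalues survive. *)
Lemma spectral_radius_lt1P n (M : 'M[R]_n) :
  spectral_radius M < 1 <-> forall z, eigenvalue (cplx M) z -> normc z < 1.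
Proof.
have [s Es] := eigenvalue_seq (cplx M).
pose b := \big[Num.max/0]_(z <- s) normc z.
have ub z : z \in s -> normc z <= b by move=> zs; apply: le_bigmax_seq.
split=> [rho z ez|h].
  apply: le_lt_trans rho; apply: ub_le_sup; last by exists z.
  by exists b => _ [y /= ey <-]; apply: ub; rewrite -Es.
have b1 : b < 1.
  by rewrite /b big_seq; apply: bigmax_lt => // z; rewrite -Es => /h.
(* An empty spectrum occurs in dimension 0; the supremum is then 0. *)
have [E0|/set0P Ene] := eqVneq [set normc z | z in [set z | eigenvalue (cplx M) z]] set0.
  by rewrite /spectral_radius E0 sup0.
apply: le_lt_trans b1; apply: ge_sup => // _ [y /= ey <-].
by apply: ub; rewrite -Es.
Qed.

(** On the real and imaginary parts of [v], the real matrix [N] acts as multiplication by [z], a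
    scaled rotation: the cross terms of the two squared norms cancel. *)
Lemma sqnorm_eigen n (N : 'M[R]_n) (v : 'rV[R[i]]_n) z :
  v *m cplx N = z *: v ->
  let a := map_mx (@complex.Re R) v in let b := map_mx (@complex.Im R) v in
  sqnorm (a *m N) + sqnorm (b *m N) = normc z ^+ 2 * (sqnorm a + sqnorm b).
Proof.
move=> Ev a b.
have Ea : a *m N = complex.Re z *: a - complex.Im z *: b.
  apply/rowP => j; have := congr1 (fun w : 'rV_n => complex.Re (w 0 j)) Ev.
  rewrite !mxE raddf_sum /=; move: (v 0 j) => [x y] /=.
  case: z {Ev} => p q /= <-; apply: eq_bigr => i _; rewrite !mxE.
  by case: (v 0 i) => ? ? /=; rewrite mulr0 subr0.
have Eb : b *m N = complex.Im z *: a + complex.Re z *: b.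
  apply/rowP => j; have := congr1 (fun w : 'rV_n => complex.Im (w 0 j)) Ev.
  rewrite !mxE raddf_sum /=; move: (v 0 j) => [x y] /=.
  case: z {Ev Ea} => p q /=; rewrite addrC => <-; apply: eq_bigr => i _; rewrite !mxE.
  by case: (v 0 i) => ? ? /=; rewrite mulr0 add0r.
rewrite Ea Eb normc_sqr -scaleNr.
rewrite /sqnorm !(bformDl, bformDr, bformZl, bformZr); ring.
Qed.

Lemma sqnorm_ReIm_gt0 n (v : 'rV[R[i]]_n) : v != 0 ->
  0 < sqnorm (map_mx (@complex.Re R) v) + sqnorm (map_mx (@complex.Im R) v).
Proof.
move=> v0; rewrite lt_neqAle addr_ge0 ?sqnorm_ge0 // andbT eq_sym.
rewrite paddr_eq0 ?sqnorm_ge0 // !sqnorm_eq0.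
apply: contra v0 => /andP[/eqP a0 /eqP b0]; apply/eqP/rowP => i; rewrite !mxE.
have := congr1 (fun w : 'rV_n => w 0 i) a0.
have := congr1 (fun w : 'rV_n => w 0 i) b0.
by rewrite !mxE; case: (v 0 i) => x y /= -> ->.
Qed.

Lemma eigenvector_exp n (M : 'M[R[i]]_n) (v : 'rV[R[i]]_n) z k :
  v *m M = z *: v -> v *m M ^+ k = z ^+ k *: v.
Proof.
move=> Ev; elim: k => [|k IH].
  by rewrite !expr0 scale1r; apply: mulmx1.
by rewrite [M ^+ _]exprS [LHS]mulmxA Ev -scalemxAl IH scalerA -exprS.
Qed.

Lemma cplx_exp n (M : 'M[R]_n) k : cplx (M ^+ k) = cplx M ^+ k.
Proof.
elim: k => [|k IH]; first by rewrite !expr0 [LHS]map_mx1.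
by rewrite !exprS [LHS]map_mxM IH.
Qed.

(** Testing the contraction on an eigenvector gives [|z|^(2K) <= kappa < 1]. A power is needed
    because a stable matrix may itself increase the Euclidean norm. *)
Lemma contracting_power_spectral_radius n (M : 'M[R]_n) K kappa :
  kappa < 1 -> (forall x, sqnorm (x *m M ^+ K) <= kappa * sqnorm x) ->
  spectral_radius M < 1.
Proof.
move=> k1 h; apply/spectral_radius_lt1P => z /eigenvalueP[v Ev v0].
have Ev' : v *m cplx (M ^+ K) = z ^+ K *: v.
  by rewrite cplx_exp; apply: eigenvector_exp.
have s0 := sqnorm_ReIm_gt0 v0.
have := sqnorm_eigen Ev'; set a := map_mx _ v; set b := map_mx _ v => E.
have : normc (z ^+ K) ^+ 2 * (sqnorm a + sqnorm b) <= kappa * (sqnorm a + sqnorm b).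
  by rewrite -E mulrDr lerD.
rewrite ler_pM2r // normcX -exprM => hz.
rewrite ltNge; apply/negP => z1.
have : 1 <= normc z ^+ (K * 2) by apply: exprn_ege1.
by rewrite leNgt (le_lt_trans hz).
Qed.

(** * Geometric decay of the powers of a stable matrix *)

Definition geom_decay (u : nat -> R[i]) :=
  exists C q : R, [/\ 0 <= C, 0 <= q < 1 & forall k, normc (u k) <= C * q ^+ k].

Lemma geom_decay_recurrence (u w : nat -> R[i]) z :
  normc z < 1 -> geom_decay w -> (forall k, u k.+1 = z * u k + w k) ->
  geom_decay u.
Proof.
move=> z1 [C [q [C0 /andP[q0 q1] hw]]] hu.
(* A rate [r'] strictly above both [q] and [|z|] also covers the resonant case [q = |z|], where the
   sequence may grow like [k q^k]. *)
pose r := Num.max q (normc z); pose r' := (1 + r) / 2.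
have r1 : r < 1 by rewrite gt_max q1.
have r0 : 0 <= r by rewrite le_max q0.
have rr' : r < r' by rewrite /r'; lra.
(* The second term gives [r C' + C <= r' C'], which closes the induction; the first starts it. *)
pose C' := Num.max (normc (u 0%N)) (C / (r' - r)).
have C'0 : 0 <= C' by rewrite le_max normc_ge0.
have hC : C <= (r' - r) * C'.
  by rewrite mulrC -ler_pdivrMr ?subr_gt0 // /C' le_max lexx orbT.
exists C', r'; split=> //; first by rewrite /r'; apply/andP; split; lra.
elim=> [|k IH]; first by rewrite expr0 mulr1 /C' le_max lexx.
rewrite hu; apply: le_trans (le_normcD _ _) _; rewrite Normc.normcM.
have qr : q ^+ k <= r' ^+ k.
  by rewrite lerXn2r ?nnegrE //; [lra|rewrite (le_trans _ (ltW rr')) // le_max lexx].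
have h1 : normc z * normc (u k) <= r * (C' * r' ^+ k).
  by apply: ler_pM; rewrite ?normc_ge0 // le_max lexx orbT.
have h2 : normc (w k) <= C * r' ^+ k by apply: le_trans (hw k) _; apply: ler_wpM2l.
have h3 : C * r' ^+ k <= (r' - r) * C' * r' ^+ k.
  by apply: ler_wpM2r hC; apply: exprn_ge0; lra.
rewrite exprS; lra.
Qed.

(* By Cayley-Hamilton [N = 1%:M] and [s] the list of eigenvalues satisfy the
   hypothesis; the factors are removed one at a time. *)
Lemma geom_decay_annihilated n (M : 'M[R[i]]_n) s (N : 'M[R[i]]_n) :
  (forall z, z \in s -> normc z < 1) ->
  N *m \prod_(z <- s) (M - z%:M) = 0 ->
  forall i j, geom_decay (fun k => (N *m M ^+ k) i j).
Proof.
elim: s N => [|z s IH] N hs.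
  rewrite big_nil => E i j; exists 0, 0; split; rewrite ?lexx ?ltr01 // => k.
  have -> : N = 0 by rewrite -[LHS]mulmx1.
  by rewrite mul0mx mxE Normc.normc0 mul0r.
rewrite big_cons [N *m _]mulmxA => E i j.
have hz : normc z < 1 by apply: hs; rewrite mem_head.
apply: (geom_decay_recurrence hz (IH _ _ E i j)).
  by move=> y ys; apply: hs; rewrite inE ys orbT.
move=> k; rewrite mulmxBr mulmxBl mul_mx_scalar -scalemxAl exprS [N *m (_ * _)]mulmxA !mxE.
by rewrite [RHS]addrC subrK.
Qed.

(** Over the complex numbers the characteristic polynomial splits, and Cayley-Hamilton makes the
    product over its roots annihilate [M]. The resulting geometric bound transfers to the real
    entries. *)
Lemma spectral_radius_cvg n (M : 'M[R]_n) : spectral_radius M < 1 ->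
  forall i j, (fun k => (M ^+ k) i j) @ \oo --> (0 : R).
Proof.
move/spectral_radius_lt1P; case: n M => [|n] M rho i j; first by case: i.
have [s Es] := closed_field_poly_normal (char_poly (cplx M)).
rewrite (monicP (char_poly_monic _)) scale1r in Es.
have hs z : z \in s -> normc z < 1.
  by move=> zs; apply: rho; rewrite eigenvalue_root_char Es root_prod_XsubC.
have CH : 1%:M *m \prod_(z <- s) (cplx M - z%:M) = 0.
  rewrite mul1mx; have := Cayley_Hamilton (cplx M); rewrite Es rmorph_prod /= => <-.
  by apply: eq_bigr => z _; rewrite rmorphB /= horner_mx_X horner_mx_C.
have [C [q [C0 /andP[q0 q1] h]]] := geom_decay_annihilated hs CH i j.
apply/norm_cvg0P.
apply: (@squeeze_cvgr _ _ _ _ (fun=> 0) (geometric C q)).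
- near=> k; rewrite normr_ge0 /=; have := h k.
  by rewrite mul1mx -cplx_exp mxE normc_real.
- exact: cvg_cst.
- by apply: cvg_geometric; rewrite ger0_norm.
Unshelve. all: by end_near. Qed.

Lemma cvg_closed (V : Type) (x_ : nat -> V) (x : V) (P := fun f : V -> R =>
    (fun k => f (x_ k)) @ \oo --> f x) :
  [/\ forall c, P (fun=> c), forall f g, P f -> P g -> P (fun y => f y + g y),
    forall f g, P f -> P g -> P (fun y => f y * g y) &
    forall f g, f =1 g -> P f -> P g].
Proof.
rewrite /P; split=> [c|f g Pf Pg|f g Pf Pg|f g /funext <-] //.
- exact: cvg_cst.
- exact: cvgD.
- exact: cvgM.
Qed.

End SpectralRadius.

(** * The Lyapunov equation *)

Section Lyapunov.
Variables (R : realType) (n : nat).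
Implicit Types M S W : 'M[R]_n.

Definition lyapunov M S := S = 1%:M + M *m S *m M^T.

(* Matrix, on vectorised [S], of the operator [S |-> S - M S M^T]. *)
Definition lyap_mx M : 'M[R]_(n * n) := 1%:M - lin_mulmx M *m lin_mulmxr M^T.

Definition lyap_sol M : 'M[R]_n :=
  vec_mx (mxvec (1%:M : 'M[R]_n) *m invmx (lyap_mx M)).

Lemma mul_mxvec_lyap M S : mxvec S *m lyap_mx M = mxvec (S - M *m S *m M^T).
Proof.
by rewrite mulmxBr mulmx1 mulmxA !mul_vec_lin /= linearB.
Qed.

Lemma lyapunov_sol M S : lyap_mx M \in unitmx ->
  lyapunov M S <-> S = lyap_sol M.
Proof.
move=> uL; rewrite /lyapunov /lyap_sol; split=> [E|->].
  have -> : (1%:M : 'M[R]_n) = S - M *m S *m M^T by rewrite {1}E addrK.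
  by rewrite -mul_mxvec_lyap mulmxK // mxvecK.
set T := vec_mx _.
have : mxvec T *m lyap_mx M = mxvec (1%:M : 'M[R]_n) by rewrite vec_mxK mulmxKV.
by rewrite mul_mxvec_lyap => /(can_inj mxvecK) <-; rewrite subrK.
Qed.

Lemma iter_conj M S : S = M *m S *m M^T ->
  forall k, S = M ^+ k *m S *m (M ^+ k)^T.
Proof.
move=> E; elim=> [|k IH]; first by rewrite expr0 trmx1 mulmx1 mul1mx.
rewrite exprS -[M * _]/(M *m _) trmx_mul !mulmxA -(mulmxA M) -(mulmxA M).
by rewrite -IH -E.
Qed.

(** A kernel vector is a matrix [S = M S M^T], hence [S = M^k S (M^k)^T] for every [k]; the right
    side tends to 0 while the left is constant. *)
Lemma lyap_mx_unit M : spectral_radius M < 1 -> lyap_mx M \in unitmx.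
Proof.
move=> rho; rewrite unitmxE unitfE; apply/negP => /det0P[v v0 Ev].
have E : vec_mx v - M *m vec_mx v *m M^T = 0.
  by apply: (can_inj mxvecK); rewrite -mul_mxvec_lyap vec_mxK Ev linear0.
have {}E := iter_conj (subr0_eq E).
have S0 : vec_mx v = 0 :> 'M[R]_n.
  apply/matrixP => i j; rewrite [RHS]mxE.
  pose f (X : 'M[R]_n) := (X *m vec_mx v *m X^T) i j.
  have [Pc PD PM Pe] := cvg_closed R (fun k => M ^+ k) (0 : 'M[R]_n).
  have : (fun k => f (M ^+ k)) @ \oo --> f 0.
    have Mc : entrywise (fun g : 'M[R]_n -> R => (fun k => g (M ^+ k)) @ \oo --> g 0) id.
      by move=> a b; rewrite [X in _ --> X]mxE; apply: spectral_radius_cvg.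
    have h := entrywiseM Pc PD PM Pe Mc (entrywise_cst Pc (vec_mx v)).
    exact: (entrywiseM Pc PD PM Pe h (entrywise_tr Pe Mc) i j).
  rewrite {2}/f mul0mx mul0mx mxE.
  have -> : (fun k => f (M ^+ k)) = fun=> vec_mx v i j.
    by apply/funext => k; rewrite /f -E.
  by move=> h; apply: (cvg_unique _ (cvg_cst _) h).
by move: v0; rewrite -[v]vec_mxK S0 linear0 eqxx.
Qed.

Lemma lyapunov_expand M S k : lyapunov M S ->
  S = \sum_(j < k) M ^+ j *m (M ^+ j)^T + M ^+ k *m S *m (M ^+ k)^T.
Proof.
move=> E; elim: k => [|k IH].
  by rewrite big_ord0 add0r expr0 trmx1 mulmx1 mul1mx.
rewrite {1}IH big_ord_recr /= -addrA; congr (_ + _).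
rewrite {1}E mulmxDr mulmx1 mulmxDl; congr (_ + _).
by rewrite exprSr -[_ * M]/(_ *m M) trmx_mul !mulmxA.
Qed.

(** By cyclicity the trace is the sum of the form [W] over the columns of [N]. *)
Lemma trace_mul_sqr_ge0 p W (N : 'M[R]_(n, p)) :
  (forall x, 0 <= bform W x x) -> 0 <= \tr (W *m (N *m N^T)).
Proof.
move=> hW; rewrite mulmxA mxtrace_mulC mulmxA /mxtrace.
apply: sumr_ge0 => i _.
have -> : (N^T *m W *m N) i i = bform W (row i N^T) (row i N^T).
  rewrite /bform tr_row trmxK -row_mul [LHS]mxE [RHS]mxE.
  by apply: eq_bigr => k _; rewrite [row _ _ _ _]mxE [col _ _ _ _]mxE.
exact: hW.
Qed.

(** Unrolling the equation [k] times writes [S] as a sum of squares plus a remainder. The squares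
    contribute nonnegative traces and the remainder vanishes as [k] grows. The bounds on [Sigma] and
    on the cost below are instances for suitable [W]. *)
Lemma trace_lyapunov_ge0 M S W :
  spectral_radius M < 1 -> lyapunov M S ->
  (forall x, 0 <= bform W x x) -> 0 <= \tr (W *m S).
Proof.
move=> rho E hW.
pose f (X : 'M[R]_n) := \tr (W *m (X *m S *m X^T)).
have [Pc PD PM Pe] := cvg_closed R (fun k => M ^+ k) (0 : 'M[R]_n).
have : (fun k => f (M ^+ k)) @ \oo --> f 0.
  have Mc : entrywise (fun g : 'M[R]_n -> R => (fun k => g (M ^+ k)) @ \oo --> g 0) id.
    by move=> a b; rewrite [X in _ --> X]mxE; apply: spectral_radius_cvg.
  have h1 := entrywiseM Pc PD PM Pe Mc (entrywise_cst Pc S).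
  have h2 := entrywiseM Pc PD PM Pe h1 (entrywise_tr Pe Mc).
  exact: (closed_trace Pc PD Pe (entrywiseM Pc PD PM Pe (entrywise_cst Pc W) h2)).
rewrite {2}/f mul0mx mul0mx mulmx0 mxtrace0 => cf.
apply: (ler_cvg_to cf (cvg_cst (\tr (W *m S)))).
apply: nearW => k; rewrite [X in W *m X](lyapunov_expand k E) mulmxDr mxtraceD.
rewrite lerDr mulmx_sumr raddf_sum; apply: sumr_ge0 => j _.
exact: trace_mul_sqr_ge0.
Qed.

Lemma trace_rank1 S (x : 'rV[R]_n) : \tr (x^T *m x *m S) = bform S x x.
Proof. by rewrite mxtrace_mulC mulmxA mxtrace_mulC mulmxA trace_mx11. Qed.

Lemma bform_lyapunov_ge0 M S x :
  spectral_radius M < 1 -> lyapunov M S -> 0 <= bform S x x.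
Proof.
move=> rho E; rewrite -trace_rank1; apply: (trace_lyapunov_ge0 rho E) => y.
rewrite /bform !mulmxA -mulmxA mxE big_ord1.
have -> : (x *m y^T) 0 0 = (y *m x^T) 0 0.
  by rewrite -[x *m y^T]trmxK mxE trmx_mul trmxK.
by rewrite -expr2 sqr_ge0.
Qed.

Lemma bform_lyapunov_le_trace M S x :
  spectral_radius M < 1 -> lyapunov M S -> bform S x x <= \tr S * sqnorm x.
Proof.
move=> rho E; rewrite -subr_ge0 -trace_rank1 mulrC.
(* The weight is [W = (sqnorm x) I - x^T x], nonnegative by Cauchy-Schwarz. *)
rewrite -mxtraceZ -mul_scalar_mx -raddfB /= -mulmxBl.
apply: (trace_lyapunov_ge0 rho E) => y.
rewrite bformBm.
have -> : bform (sqnorm x)%:M y y = sqnorm x * sqnorm y.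
  by rewrite /sqnorm {1}/bform mul_mx_scalar -scalemxAl mxE /bform !mulmx1.
have -> : bform (x^T *m x) y y = bform 1%:M x y ^+ 2.
  rewrite /bform !mulmxA -mulmxA mxE big_ord1 mulmx1.
  have -> : (x *m y^T) 0 0 = (y *m x^T) 0 0.
    by rewrite -[x *m y^T]trmxK mxE trmx_mul trmxK.
  by rewrite expr2.
rewrite subr_ge0; apply: cauchy_schwarz_bform; first exact: trmx1.
exact: sqnorm_posdef.
Qed.

(** The equation reads [S(yM,yM) = S(y,y) - |y|^2], and [S <= c I] turns this into a decrease by the
    factor [1 - 1/c]. The sandwich [|y|^2 <= S(y,y) <= c |y|^2] converts the decay back to the
    Euclidean norm. *)
Lemma lyapunov_power_bound M S c x k :
  lyapunov M S -> (forall y, 0 <= bform S y y <= c * sqnorm y) -> 1 <= c ->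
  sqnorm (x *m M ^+ k) <= c * (1 - c^-1) ^+ k * sqnorm x.
Proof.
move=> E hS c1.
have c0 : 0 < c by apply: lt_le_trans c1.
have step y : bform S y y = sqnorm y + bform S (y *m M) (y *m M).
  by rewrite {1}E bformDm bform_conj.
have th0 : 0 <= 1 - c^-1 by rewrite subr_ge0 invf_le1.
have dec : bform S (x *m M ^+ k) (x *m M ^+ k) <= (1 - c^-1) ^+ k * bform S x x.
  elim: k => [|k IH]; first by rewrite expr0 mul1r [x *m _]mulmx1.
  rewrite exprSr -[_ * M]/(_ *m M) [x *m _]mulmxA.
  set y := x *m _ in IH *.
  have /andP[_ hy] := hS y.
  have : c^-1 * bform S y y <= sqnorm y by rewrite mulrC ler_pdivrMr // mulrC.
  have := ler_wpM2l th0 IH; rewrite mulrA -exprS; have := step y; lra.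
have h1 : sqnorm (x *m M ^+ k) <= bform S (x *m M ^+ k) (x *m M ^+ k).
  rewrite step lerDl; by case/andP: (hS (x *m M ^+ k *m M)).
apply: le_trans h1 (le_trans dec _).
rewrite mulrAC mulrC ler_wpM2r ?exprn_ge0 //; by case/andP: (hS x).
Qed.

(** The exponent depends on [c] alone, which makes the contraction uniform over all gains sharing
    the bound [c]. *)
Lemma exists_pow_lt1 (c : R) : 1 <= c -> exists k, c * (1 - c^-1) ^+ k < 1.
Proof.
move=> c1; have c0 : 0 < c by apply: lt_le_trans c1.
have th0 : 0 <= 1 - c^-1 by rewrite subr_ge0 invf_le1.
have cv : (fun k => c * (1 - c^-1) ^+ k) @ \oo --> (0 : R).
  apply: (@cvg_geometric R c (1 - c^-1)).
  by rewrite ger0_norm // ltrBlDr ltrDl invr_gt0.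
have : \forall k \near \oo, c * (1 - c^-1) ^+ k < 1.
  exact: (cvgr_lt 0 cv).
by move=> [N _ hN]; exists N; apply: hN => /=.
Qed.

Lemma lyapunov_psd_spectral_radius M S :
  lyapunov M S -> (forall x, 0 <= bform S x x) -> spectral_radius M < 1.
Proof.
move=> E hS; pose c := 1 + \sum_i \sum_j `|S i j|.
have s0 : 0 <= \sum_i \sum_j `|S i j|.
  by apply: sumr_ge0 => i _; apply: sumr_ge0.
have c1 : 1 <= c by rewrite lerDl.
have [k hk] := exists_pow_lt1 c1.
apply: (contracting_power_spectral_radius (K := k) hk) => x.
apply: (lyapunov_power_bound x k E) => // y; rewrite hS /=.
apply: le_trans (ler_norm _) (le_trans (ler_bform S y) _).
by rewrite ler_wpM2r ?sqnorm_ge0 // lerDr.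
Qed.

End Lyapunov.

(** * Real functions of one variable *)

Section RealFunctions.
Variable R : realType.
Implicit Types (p : {poly R}) (f : R -> R).

(** Take the supremum of the [u] such that [P] holds on [[0,u)]. The first hypothesis gives [P]
    there; if it were below [b], the second would produce a larger member. *)
Lemma real_induction (P : R -> Prop) (b : R) :
  (forall t, 0 <= t <= b -> (forall s, 0 <= s < t -> P s) -> P t) ->
  (forall t, 0 <= t < b -> (forall s, 0 <= s <= t -> P s) ->
     exists2 h, 0 < h & forall s, t < s < t + h -> P s) ->
  forall t, 0 <= t <= b -> P t.
Proof.
move=> Pclosed Popen t /andP[t0 tb].
have b0 : 0 <= b := le_trans t0 tb.
pose E := [set u | 0 <= u <= b /\ forall s, 0 <= s < u -> P s].
have E0 : E 0 by split; [rewrite lexx | move=> s /andP[/le_lt_trans/[apply]]; rewrite ltxx].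
have supE : has_sup E by split; [exists 0 | exists b => u [/andP[]]].
have s0 : 0 <= sup E by apply: ub_le_sup => //; case: supE.
have sb : sup E <= b by apply: ge_sup; [exists 0 | move=> u [/andP[]]].
have Plt s : 0 <= s < sup E -> P s.
  move=> /andP[s0' hs].
  have [u [_ Pu] su] : exists2 u, E u & s < u.
    have e0 : 0 < sup E - s by rewrite subr_gt0.
    by have [u Eu] := sup_adherent e0 supE; rewrite subKr; exists u.
  by apply: Pu; rewrite s0' su.
have Psup : P (sup E) by apply: Pclosed => //; rewrite s0 sb.
have Ple s : 0 <= s <= sup E -> P s.
  by move=> /andP[s0']; rewrite le_eqVlt => /predU1P[->//|hs]; apply: Plt; rewrite s0'.
have [sbE|sltb] := eqVneq (sup E) b; first by apply: Ple; rewrite sbE t0.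
have {}sltb : sup E < b by rewrite lt_neqAle sltb.
have [||h h0 Ph] := Popen (sup E); [by rewrite s0 | exact: Ple |].
pose u := Num.min b (sup E + h).
have Eu : E u.
  split; first by rewrite le_min b0 ge_min lexx addr_ge0 // ltW.
  move=> s /andP[s0']; rewrite lt_min => /andP[_ hs].
  have [hs'|hs'] := leP s (sup E); first by apply: Ple; rewrite s0'.
  by apply: Ph; rewrite hs'.
have : u <= sup E by apply: ub_le_sup => //; case: supE.
by rewrite leNgt lt_min sltb ltrDl h0.
Qed.

Lemma continuous_le_left f (K t : R) : 0 < t -> {for t, continuous f} ->
  (forall s, 0 <= s < t -> f s <= K) -> f t <= K.
Proof.
move=> t0 cf hf.
apply: (cvgr_to_le (cvg_at_left_filter cf)).
near=> s; apply: hf; apply/andP; split; last by near: s; apply: nbhs_left_lt.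
by near: s; apply: nbhs_left_ge.
Unshelve. all: by end_near. Qed.

Lemma derivative_ge0_le (h dh : R -> R) (b : R) :
  (forall x : R, 0 <= x <= b -> is_derive x 1 h (dh x)) ->
  (forall x : R, 0 <= x <= b -> 0 <= dh x) -> 0 <= b -> h 0 <= h b.
Proof.
move=> dP dge b0.
have [x /[!in_itv] /= xb E] : exists2 c, c \in `[0, b] & h b - h 0 = dh c * (b - 0).
  apply: MVT_segment => // [x /[!in_itv] /= /andP[x0 xb]|].
    by apply: dP; rewrite !ltW.
  apply: derivable_within_continuous => x /[!in_itv] /= xb.
  by have [] := dP x xb.
by rewrite -subr_ge0 E subr0 mulr_ge0 // dge.
Qed.

(** Monotonicity is used twice, for [l y - r1 y] and then for [r1 0 * y + l y^2 / 2 - r0 y]. The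
    slope bound is kept because it controls the sign of the derivative along the descent path. *)
Lemma taylor2_le (r0 r1 r2 : R -> R) (b l : R) :
  (forall x : R, 0 <= x <= b -> is_derive x 1 r0 (r1 x)) ->
  (forall x : R, 0 <= x <= b -> is_derive x 1 r1 (r2 x)) ->
  (forall x : R, 0 <= x <= b -> r2 x <= l) -> 0 <= b ->
  r1 b <= r1 0 + l * b /\ r0 b <= r0 0 + r1 0 * b + l * b ^+ 2 / 2.
Proof.
move=> d0 d1 hl b0.
have H1 (x : R) : 0 <= x <= b -> r1 x <= r1 0 + l * x.
  move=> /andP[x0 xb].
  have sub (y : R) : 0 <= y <= x -> 0 <= y <= b by move=> /andP[-> /le_trans ->].
  pose h (y : R) := l * y - r1 y; pose dh (y : R) := l - r2 y.
  have : h 0 <= h x.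
    apply: (@derivative_ge0_le h dh x) => [y /sub yb|y /sub yb|//].
      have d := d1 y yb.
      by apply: is_derive_eq; rewrite /dh /GRing.scale /= mulr1.
    by rewrite subr_ge0 hl.
  rewrite /h; lra.
split; first by apply: H1; rewrite b0 lexx.
pose h (y : R) := r1 0 * y + l / 2 * y ^+ 2 - r0 y.
pose dh (y : R) := r1 0 + l * y - r1 y.
have : h 0 <= h b.
  apply: (@derivative_ge0_le h dh b) => [y yb|y yb|//].
    have d := d0 y yb.
    by apply: is_derive_eq; rewrite /dh /GRing.scale /=; lra.
  by rewrite subr_ge0 H1.
rewrite /h expr0n /=; lra.
Qed.

(** * Rational functions of one variable *)

Definition ratfun p q (u : R) := p.[u] / q.[u].

Lemma horner_neq0_near p (u : R) : p.[u] != 0 -> \forall v \near u, p.[v] != 0.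
Proof.
move=> pu; apply: (@continuous_horner R p u [set y | y != 0]).
by apply: open_nbhs_nbhs; split => //; apply: open_neq.
Qed.

(** The derivative is again a quotient of polynomials, so the same formula applied twice yields the
    second derivative. *)
Lemma is_derive_ratfun p q (u : R) : q.[u] != 0 ->
  is_derive u 1 (ratfun p q) (ratfun (p^`() * q - p * q^`()) (q * q) u).
Proof.
move=> qu.
have dV : is_derive u 1 (fun v => q.[v]^-1) (- q.[u] ^- 2 *: q^`().[u]).
  exact: is_deriveV.
have dM := is_deriveM (is_derive_poly p u) dV.
apply: (is_derive_eq dM).
rewrite /ratfun hornerD hornerN !hornerM.
rewrite [LHS](_ : _ = p.[u] * (- q.[u] ^- 2 * q^`().[u]) + q.[u]^-1 * p^`().[u]) //.
by field.
Qed.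

Lemma continuous_ratfun p q (u : R) : q.[u] != 0 ->
  {for u, continuous (ratfun p q)}.
Proof.
move=> qu; apply: differentiable_continuous.
by apply/derivable1_diffP; have [] := is_derive_ratfun p qu.
Qed.

Lemma derive_lt0_right f (t d : R) : is_derive t 1 f d -> d < 0 ->
  exists2 h, 0 < h & forall s, t < s < t + h -> f s <= f t.
Proof.
move=> [df dE] d0.
have cf : (fun h : R => h^-1 *: (f (h *: 1 + t) - f t)) @ 0^' --> d by rewrite -dE.
have near0 : nbhs (0 : R) [set h | h != 0 -> h^-1 *: (f (h *: 1 + t) - f t) < 0].
  exact: (cvgr_lt _ cf _ d0).
have [e /= e0 he] := (nbhs_ballP _ _).1 near0.
exists e => // s /andP[ts ste].
have scale1E (h : R) : h *: (1 : R) = h := mulr1 h.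
have st0 : 0 < s - t by rewrite subr_gt0.
have := he (s - t); rewrite /ball /= sub0r normrN gtr0_norm // ltrBlDl => /(_ ste).
rewrite gt_eqF // => /(_ isT); rewrite scale1E subrK.
by rewrite pmulr_rlt0 ?invr_gt0 // subr_lt0 => /ltW.
Qed.

End RealFunctions.

Lemma derive1_shift (R : realType) (f : R -> R) (s t : R) :
  (fun x => f (s + x))^`()%classic t = f^`()%classic (s + t).
Proof.
rewrite !derive1E /derive.
pose F (h : R) := h^-1 *: ((f \o shift (s + t)) (h *: 1) - f (s + t)).
rewrite (_ : (fun h => h^-1 *: _) = F) //; apply/funext => h.
by rewrite /F /= addrCA.
Qed.

Lemma derive_line (R : realType) (V : normedModType R) (f : V -> R) (a v : V) :
  'D_v f a = (fun u : R => f (a + u *: v))^`()%classic 0.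
Proof.
rewrite derive1E /derive.
pose F (h : R) := h^-1 *: (f (h *: v + a) - f a).
have scale1E (h : R) : h *: (1 : R) = h := mulr1 h.
rewrite [LHS](_ : _ = lim (F @ 0^')) //.
rewrite [in RHS](_ : (fun h => h^-1 *: _) = F) //; apply/funext => h /=.
by rewrite /F scale1E scale0r !addr0 [a + _]addrC.
Qed.

(** * Matrix norms and the projection *)

Section MatrixNorms.
Variable R : realType.

Lemma frobenius_norm_ge0 p q (M : 'M[R]_(p, q)) : 0 <= frobenius_norm M.
Proof. exact: sqrtr_ge0. Qed.

Lemma frobenius_norm_sqr p q (M : 'M[R]_(p, q)) :
  frobenius_norm M ^+ 2 = \sum_(i < p) \sum_(j < q) M i j ^+ 2.
Proof.
by rewrite sqr_sqrtr //; apply: sumr_ge0 => i _; apply: sumr_ge0 => j _; apply: sqr_ge0.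
Qed.

Lemma frobenius_norm_trace p q (M : 'M[R]_(p, q)) :
  frobenius_norm M ^+ 2 = \tr (M^T *m M).
Proof.
rewrite frobenius_norm_sqr exchange_big; apply: eq_bigr => j _.
by rewrite mxE; apply: eq_bigr => i _; rewrite mxE expr2.
Qed.

Lemma frobenius_norm_eq0 p q (M : 'M[R]_(p, q)) : frobenius_norm M = 0 -> M = 0.
Proof.
move=> E; have := frobenius_norm_sqr M; rewrite E expr0n /= => /esym/eqP.
have sq0 (i : 'I_p) : 0 <= \sum_(j < q) M i j ^+ 2.
  by apply: sumr_ge0 => j _; apply: sqr_ge0.
rewrite psumr_eq0 // => /allP h; apply/matrixP => i j; rewrite mxE.
have := h i (mem_index_enum _); rewrite /= psumr_eq0; last by move=> k _; apply: sqr_ge0.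
by move=> /allP/(_ j (mem_index_enum _)); rewrite /= sqrf_eq0 => /eqP.
Qed.

Lemma frobenius_normZ p q a (M : 'M[R]_(p, q)) :
  frobenius_norm (a *: M) = `|a| * frobenius_norm M.
Proof.
rewrite /frobenius_norm -sqrtr_sqr -sqrtrM ?sqr_ge0 // mulr_sumr.
congr Num.sqrt; apply: eq_bigr => i _; rewrite mulr_sumr.
by apply: eq_bigr => j _; rewrite mxE exprMn.
Qed.

Lemma frobenius_norm_mulmx_cV p q (M : 'M[R]_(p, q)) (x : 'cV_q) :
  frobenius_norm (M *m x) <= frobenius_norm M * frobenius_norm x.
Proof.
rewrite -ler_sqr ?nnegrE ?mulr_ge0 ?frobenius_norm_ge0 // exprMn !frobenius_norm_sqr.
rewrite mulr_suml; apply: ler_sum => i _; rewrite big_ord1.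
have := cauchy_schwarz_bform (row i M) x^T (trmx1 _ _) (@sqnorm_posdef R q).
have -> : bform 1%:M (row i M) x^T = (M *m x) i 0.
  by rewrite /bform mulmx1 trmxK -row_mul mxE.
rewrite -/(sqnorm _) -/(sqnorm x^T) !sqnormE => /le_trans; apply.
rewrite le_eqVlt; apply/orP; left; apply/eqP.
congr (_ * _); apply: eq_bigr => j _; rewrite ?big_ord1 !mxE //.
Qed.

(** This links gradient dominance, stated in the spectral norm, to the descent inequality, which is
    in the Frobenius norm. *)
Lemma spectral_norm_le_frobenius p q (M : 'M[R]_(p, q)) :
  spectral_norm M <= frobenius_norm M.
Proof.
rewrite /spectral_norm; set E := [set _ | _ in _].
(* Without columns there is no unit vector and the supremum is 0. *)
have [->|/set0P Ene] := eqVneq E set0; first by rewrite sup0 frobenius_norm_ge0.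
apply: ge_sup => // _ [x /= x1 <-].
by rewrite -[leRHS]mulr1 -x1 frobenius_norm_mulmx_cV.
Qed.

Lemma gram_unitmx n p (X : 'M[R]_(n, p)) : row_free X -> X *m X^T \in unitmx.
Proof.
move=> fX; rewrite -row_free_unit; apply/inj_row_free => v Ev.
have : sqnorm (v *m X) = 0.
  by rewrite /sqnorm /bform mulmx1 trmx_mul mulmxA -(mulmxA v) Ev mul0mx mxE.
move/eqP; rewrite sqnorm_eq0 => /eqP E; apply: (row_free_inj fX).
by rewrite E mul0mx.
Qed.

Section Projection.
Variables (n p : nat) (X : 'M[R]_(n, p)).
Hypothesis freeX : row_free X.
Let uX := gram_unitmx freeX.

Lemma mul_proj_null : X *m proj_null X = 0.
Proof.
by rewrite mulmxBr mulmx1 !mulmxA mulmxV // mul1mx subrr.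
Qed.

Lemma proj_null_sym : (proj_null X)^T = proj_null X.
Proof.
rewrite /proj_null linearB /= trmx1 !trmx_mul trmxK trmx_inv trmx_mul trmxK.
by rewrite mulmxA.
Qed.

Lemma proj_null_idem : proj_null X *m proj_null X = proj_null X.
Proof. by rewrite {1}/proj_null mulmxBl mul1mx -!mulmxA mul_proj_null !mulmx0 subr0. Qed.

(** The projection is symmetric and idempotent. With [Z] the gradient, the left side is its inner
    product with the projected gradient. *)
Lemma trace_proj_null q (Z : 'M[R]_(p, q)) :
  \tr ((proj_null X *m Z)^T *m Z) = frobenius_norm (proj_null X *m Z) ^+ 2.
Proof.
rewrite frobenius_norm_trace !trmx_mul proj_null_sym.
by rewrite -!mulmxA (mulmxA (proj_null X)) proj_null_idem.
Qed.

End Projection.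
End MatrixNorms.

(** * The LQR cost *)

Section Cost.
Variables (R : realType) (n m T : nat).
Variables (Q : 'M[R]_n) (Rw : 'M[R]_m).
Variables (Xm : 'M[R]_(n, T)) (Um : 'M[R]_(m, T)) (Xp : 'M[R]_(n, T)).
Local Notation J := (J Q Rw Um Xp).
Local Notation Sigma := (Sigma Xp).
Local Notation gradJ := (gradJ Q Rw Um Xp).
Implicit Types G Z : 'M[R]_(T, n).

Definition lyap_det G := \det (lyap_mx (Xp *m G)).
(** Numerator in Cramer's rule: the adjugate keeps it polynomial in the entries of [G], with
    [lyap_det] as common denominator. *)
Definition Sigma_num G : 'M[R]_n :=
  vec_mx (mxvec (1%:M : 'M[R]_n) *m \adj (lyap_mx (Xp *m G))).
Definition cost_weight G := Q + G^T *m Um^T *m Rw *m Um *m G.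
Definition J_num G := \tr (cost_weight G *m Sigma_num G).

Lemma lyapunovE G S :
  (S = 1%:M + Xp *m G *m S *m G^T *m Xp^T) = lyapunov (Xp *m G) S.
Proof. by rewrite /lyapunov trmx_mul !mulmxA. Qed.

(** Only nonsingularity is assumed, so this applies at gains whose stability is still to be proved,
    as in [stable_near]. *)
Lemma Sigma_lyapunov G : lyap_det G != 0 -> lyapunov (Xp *m G) (Sigma G).
Proof.
move=> d0; have uL : lyap_mx (Xp *m G) \in unitmx by rewrite unitmxE unitfE.
rewrite -lyapunovE.
apply: (@xgetPex _ 0 [set S | S = 1%:M + Xp *m G *m S *m G^T *m Xp^T]).
by exists (lyap_sol (Xp *m G)); rewrite /= lyapunovE; apply/(lyapunov_sol _ uL).
Qed.

Lemma SigmaE G : lyap_det G != 0 -> Sigma G = (lyap_det G)^-1 *: Sigma_num G.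
Proof.
move=> d0; have uL : lyap_mx (Xp *m G) \in unitmx by rewrite unitmxE unitfE.
rewrite ((lyapunov_sol _ uL).1 (Sigma_lyapunov d0)).
by rewrite /lyap_sol /invmx uL -scalemxAr linearZ.
Qed.

Lemma J_quotient G : lyap_det G != 0 -> J G = J_num G / lyap_det G.
Proof.
by move=> d0; rewrite /Defs.J SigmaE // -scalemxAr mxtraceZ mulrC.
Qed.

Lemma lyap_det_neq0 G : spectral_radius (Xp *m G) < 1 -> lyap_det G != 0.
Proof. by move/lyap_mx_unit; rewrite unitmxE unitfE. Qed.

(** * Regularity of the numerator and denominator of the cost *)

Section FunctionOfGain.
Variables (V : Type) (P : (V -> R) -> Prop) (F : V -> 'M[R]_(T, n)).
Hypothesis Pcst : forall c, P (fun=> c).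
Hypothesis PD : forall f g, P f -> P g -> P (fun x => f x + g x).
Hypothesis PM : forall f g, P f -> P g -> P (fun x => f x * g x).
Hypothesis Pext : forall f g, f =1 g -> P f -> P g.
Hypothesis PF : entrywise P F.
Let Pmul := fun p q r => @entrywiseM R V P Pcst PD PM Pext p q r.
Let Pc := fun p q => @entrywise_cst R V P Pcst p q.

Lemma entrywise_closed_loop : entrywise P (fun x => Xp *m F x).
Proof. exact: (Pmul (Pc Xp) PF). Qed.

Lemma entrywise_lyap_mx : entrywise P (fun x => lyap_mx (Xp *m F x)).
Proof.
apply: (entrywiseB Pcst PD PM Pext (Pc 1%:M)).
apply: Pmul.
  exact: (entrywise_lin_mulmx Pcst PD PM Pext entrywise_closed_loop).
apply: (entrywise_lin_mulmxr Pcst PD PM Pext).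
exact: (entrywise_tr Pext entrywise_closed_loop).
Qed.

Lemma closed_lyap_det : P (fun x => lyap_det (F x)).
Proof. exact: (closed_det Pcst PD PM Pext entrywise_lyap_mx). Qed.

Lemma entrywise_Sigma_num : entrywise P (fun x => Sigma_num (F x)).
Proof.
apply: (entrywise_vec_mx Pext).
apply: (Pmul (Pc _)); exact: (entrywise_adj Pcst PD PM Pext entrywise_lyap_mx).
Qed.

Lemma closed_J_num : P (fun x => J_num (F x)).
Proof.
apply: (closed_trace Pcst PD Pext); apply: Pmul entrywise_Sigma_num.
apply: (entrywiseD PD Pext (Pc Q)); apply: Pmul PF; apply: Pmul (Pc _).
by apply: Pmul (Pc _); apply: Pmul (Pc _); exact: (entrywise_tr Pext PF).
Qed.

End FunctionOfGain.

Lemma differentiable_closed (V : normedModType R)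
    (P := fun f : V -> R => forall x, differentiable f x) :
  [/\ forall c, P (fun=> c), forall f g, P f -> P g -> P (fun y => f y + g y),
    forall f g, P f -> P g -> P (fun y => f y * g y) &
    forall f g, f =1 g -> P f -> P g].
Proof.
rewrite /P; split=> [c x|f g Pf Pg x|f g Pf Pg x|f g /funext <-] //.
- exact: differentiableD.
- exact: differentiableM.
Qed.

(** Near [G] the cost agrees with the differentiable quotient [K], so its directional derivative is
    linear in the direction and can be expanded over the matrix units that define [gradJ]. *)
Lemma derive_J G Z : lyap_det G != 0 -> 'D_Z J G = \tr (Z^T *m gradJ G).
Proof.
move=> d0; have [Pc PD PM Pe] := differentiable_closed 'M[R]_(T, n).
have Pid : entrywise (fun f : 'M[R]_(T, n) -> R => forall x, differentiable f x) id.
  by move=> i j x; apply: differentiable_coord.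
have dd := closed_lyap_det Pc PD PM Pe Pid G.
have dn := closed_J_num Pc PD PM Pe Pid G.
have near_d : \forall G' \near G, lyap_det G' != 0.
  have cd : lyap_det @ G --> lyap_det G := differentiable_continuous dd.
  apply: (cd [set y | y != 0]).
  by apply: open_nbhs_nbhs; split => //; apply: open_neq.
pose K G' := J_num G' * (lyap_det G')^-1.
have dK : differentiable K G.
  by apply: differentiableM => //; apply: differentiableV.
have JK W : 'D_W J G = 'd K G W.
  rewrite -deriveE //; apply: near_eq_derive.
  by apply: filterS near_d => G' /J_quotient.
rewrite JK [in LHS](matrix_sum_delta Z) linear_sum /mxtrace.
under eq_bigr do rewrite linear_sum.
rewrite exchange_big; apply: eq_bigr => j _; rewrite mxE.
apply: eq_bigr => i _; rewrite linearZ /= [X in X * _]mxE [in RHS]mxE.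
by rewrite JK.
Qed.

End Cost.

(** * Descent along a segment *)

Definition polynomial_fun (R : realType) (f : R -> R) :=
  exists p : {poly R}, forall u, f u = p.[u].

Lemma polynomial_fun_closed (R : realType) (P := @polynomial_fun R) :
  [/\ forall c, P (fun=> c), forall f g, P f -> P g -> P (fun y => f y + g y),
    forall f g, P f -> P g -> P (fun y => f y * g y) &
    forall f g, f =1 g -> P f -> P g].
Proof.
rewrite /P; split=> [c|f g [p hp] [q hq]|f g [p hp] [q hq]|f g /funext <-] //.
- by exists c%:P => u; rewrite hornerC.
- by exists (p + q) => u; rewrite hornerD hp hq.
- by exists (p * q) => u; rewrite hornerM hp hq.
Qed.

Section Descent.
Variables (R : realType) (n m T : nat).
Variables (Q : 'M[R]_n) (Rw : 'M[R]_m).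
Variables (Xm : 'M[R]_(n, T)) (Um : 'M[R]_(m, T)) (Xp : 'M[R]_(n, T)).
Local Notation J := (J Q Rw Um Xp).
Local Notation Sigma := (Sigma Xp).
Local Notation gradJ := (gradJ Q Rw Um Xp).
Local Notation hessJ := (hessJ Q Rw Um Xp).
Local Notation sublevel := (sublevel Q Rw Xm Um Xp).
Local Notation lyap_det := (lyap_det Xp).
Local Notation J_num := (J_num Q Rw Um Xp).
Implicit Types G Z : 'M[R]_(T, n).

Hypotheses (hQ : sym_posdef Q) (hRw : sym_posdef Rw).

Lemma sym_posdef_bform k (S : 'M[R]_k) : sym_posdef S ->
  forall x, x != 0 -> 0 < bform S x x.
Proof.
move=> [_ hS] x x0; rewrite /bform -{1}[x]trmxK; apply: hS.
by apply: contra x0 => /eqP x0; rewrite -[x]trmxK x0 trmx0.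
Qed.

(** The difference is the trace of [Sigma] against [Q - c I] plus the input weight, both nonnegative
    as forms. *)
Lemma trace_Sigma_le G c : (forall x, c * sqnorm x <= bform Q x x) ->
  spectral_radius (Xp *m G) < 1 -> c * \tr (Sigma G) <= J G.
Proof.
move=> hc rho; rewrite -subr_ge0 /Defs.J -mxtraceZ -mul_scalar_mx -raddfB /= -mulmxBl.
apply: (trace_lyapunov_ge0 rho (Sigma_lyapunov (lyap_det_neq0 rho))) => x.
rewrite bformBm bformDm.
have -> : bform c%:M x x = c * sqnorm x.
  by rewrite /bform mul_mx_scalar -scalemxAl mxE /sqnorm /bform mulmx1.
have -> : G^T *m Um^T *m Rw *m Um *m G = (G^T *m Um^T) *m Rw *m (G^T *m Um^T)^T.
  by rewrite trmx_mul !trmxK !mulmxA.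
rewrite bform_conj subr_ge0 (le_trans (hc x)) // lerDl.
have [->|/(sym_posdef_bform hRw)/ltW//] := eqVneq (x *m (G^T *m Um^T)) 0.
by rewrite /bform !mul0mx mxE.
Qed.

Lemma closed_loop_power_bound G c x k : spectral_radius (Xp *m G) < 1 ->
  \tr (Sigma G) <= c -> 1 <= c ->
  sqnorm (x *m (Xp *m G) ^+ k) <= c * (1 - c^-1) ^+ k * sqnorm x.
Proof.
move=> rho hc c1.
have E := Sigma_lyapunov (lyap_det_neq0 rho).
apply: (lyapunov_power_bound x k E) => // y.
rewrite (bform_lyapunov_ge0 y rho E) /=.
apply: le_trans (bform_lyapunov_le_trace y rho E) _.
by rewrite ler_wpM2r ?sqnorm_ge0.
Qed.

(** * Stability and cost along a line of gains *)

Section Line.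
Variables G Z : 'M[R]_(T, n).
Local Notation line u := (G + u *: Z).

Lemma entrywise_line : entrywise (@polynomial_fun R) (fun u : R => line u).
Proof.
move=> i j; exists ((G i j)%:P + Z i j *: 'X) => u.
by rewrite !mxE hornerD hornerC hornerZ hornerX mulrC.
Qed.

Lemma line_quotient : exists N D : {poly R},
  (forall u, J_num (line u) = N.[u]) /\ (forall u, lyap_det (line u) = D.[u]).
Proof.
have [Pc PD PM Pe] := polynomial_fun_closed R.
have [N hN] := closed_J_num Q Rw Um Xp Pc PD PM Pe entrywise_line.
have [D hD] := closed_lyap_det Xp Pc PD PM Pe entrywise_line.
by exists N, D.
Qed.

Lemma sqnorm_power_polynomial x k :
  polynomial_fun (fun u => sqnorm (x *m (Xp *m line u) ^+ k)).
Proof.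
have [Pc PD PM Pe] := polynomial_fun_closed R.
have h1 := entrywise_closed_loop Xp Pc PD PM Pe entrywise_line.
have h2 := entrywiseX Pc PD PM Pe k h1.
have h3 := entrywiseM Pc PD PM Pe (entrywise_cst Pc x) h2.
have h4 := entrywiseM Pc PD PM Pe h3 (entrywise_tr Pe h3) 0 0.
by apply: Pe h4 => u; rewrite /sqnorm /bform mulmx1.
Qed.

Lemma Sigma_line_continuous s i j : lyap_det (line s) != 0 ->
  exists2 f : R -> R, {for s, continuous f} &
    forall u, lyap_det (line u) != 0 -> Sigma (line u) i j = f u.
Proof.
have [Pc PD PM Pe] := polynomial_fun_closed R.
have [N hN] := entrywise_Sigma_num Xp Pc PD PM Pe entrywise_line i j.
have [D hD] := closed_lyap_det Xp Pc PD PM Pe entrywise_line.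
rewrite hD => Ds; exists (ratfun N D); first exact: continuous_ratfun.
by move=> u Du; rewrite SigmaE // mxE hN hD mulrC.
Qed.

(** At a stable point [Sigma] dominates the identity. A perturbation whose entries sum to
    [Delta u < 1] leaves it nonnegative, and a nonnegative Lyapunov solution implies stability. *)
Lemma stable_near s : spectral_radius (Xp *m line s) < 1 ->
  \forall u \near s, spectral_radius (Xp *m line u) < 1.
Proof.
move=> rho; have ds := lyap_det_neq0 rho.
have [f hf] : exists f : 'I_n -> 'I_n -> R -> R, forall i j,
    {for s, continuous (f i j)} /\
    forall u, lyap_det (line u) != 0 -> Sigma (line u) i j = f i j u.
  have h (ij : 'I_n * 'I_n) : exists f : R -> R, {for s, continuous f} /\
    forall u, lyap_det (line u) != 0 -> Sigma (line u) ij.1 ij.2 = f u.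
    by have [f f1 f2] := Sigma_line_continuous ij.1 ij.2 ds; exists f.
  have [f hf] := choice h; exists (fun i j => f (i, j)) => i j.
  exact: (hf (i, j)).
pose Delta u := \sum_i \sum_j `|f i j u - f i j s|.
have cD : {for s, continuous Delta}.
  have Pc c : {for s, continuous (fun=> c : R)} by exact: cvg_cst.
  have PD (g h : R -> R) : {for s, continuous g} -> {for s, continuous h} ->
    {for s, continuous (fun u => g u + h u)} by move=> cg ch; exact: cvgD.
  have Pe (g h : R -> R) : g =1 h -> {for s, continuous g} -> {for s, continuous h}.
    by move=> /funext <-.
  apply: (closed_sum Pc PD Pe) => i; apply: (closed_sum Pc PD Pe) => j.
  have [cf _] := hf i j.
  by apply: cvg_norm; apply: cvgB cf _; apply: cvg_cst.
have D0 : Delta s = 0.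
  by rewrite /Delta big1 // => i _; rewrite big1 // => j _; rewrite subrr normr0.
have nD : \forall u \near s, Delta u < 1.
  by apply: (cvgr_lt _ cD); rewrite D0.
have [N [D [_ hD]]] := line_quotient.
have nd : \forall u \near s, lyap_det (line u) != 0.
  rewrite hD in ds; have := horner_neq0_near ds; apply: filterS => u.
  by rewrite hD.
near=> u.
have du : lyap_det (line u) != 0 by near: u.
have Du : Delta u < 1 by near: u.
apply: (lyapunov_psd_spectral_radius (Sigma_lyapunov du)) => x.
have E := Sigma_lyapunov ds.
have h1 : sqnorm x <= bform (Sigma (line s)) x x.
  rewrite {1}E bformDm bform_conj lerDl; exact: (bform_lyapunov_ge0 _ rho E).
have h2 := ler_bform (Sigma (line u) - Sigma (line s)) x.
have h3 : (\sum_i \sum_j `|(Sigma (line u) - Sigma (line s)) i j|) = Delta u.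
  apply: eq_bigr => i _; apply: eq_bigr => j _; rewrite !mxE.
  by have [_ fE] := hf i j; rewrite !fE.
rewrite h3 bformBm in h2.
have h4 : Delta u * sqnorm x <= sqnorm x.
  by rewrite -[leRHS]mul1r ler_wpM2r ?sqnorm_ge0 // ltW.
have h5 := lerNnormlW h2.
move: h1 h4 h5; set A := bform _ _ _; set B := bform _ _ _; set s1 := sqnorm x.
move: (Delta u * s1) => d; clear; lra.
Unshelve. all: by end_near. Qed.

Section Quotient.
Variables N D : {poly R}.
Hypothesis hN : forall u, J_num (line u) = N.[u].
Hypothesis hD : forall u, lyap_det (line u) = D.[u].
Let N1 := N^`() * D - N * D^`().
Let D1 := D * D.
Let N2 := N1^`() * D1 - N1 * D1^`().

Lemma J_line u : D.[u] != 0 -> J (line u) = ratfun N D u.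
Proof. by rewrite -hD => du; rewrite J_quotient // hN hD. Qed.

Lemma derive1_J_line u : D.[u] != 0 ->
  (fun u => J (line u))^`()%classic u = ratfun N1 D1 u.
Proof.
move=> du; have [_ <-] := is_derive_ratfun N du.
rewrite derive1E; apply: near_eq_derive.
by apply: filterS (horner_neq0_near du) => v /J_line.
Qed.

Lemma derive_J_line : D.[0] != 0 -> 'D_Z J G = ratfun N1 D1 0.
Proof.
by move=> d0; rewrite derive_line; apply: derive1_J_line.
Qed.

Lemma hessJ_line s : D.[s] != 0 ->
  hessJ (line s) Z = ratfun N2 (D1 * D1) s.
Proof.
move=> ds; rewrite /Defs.hessJ /derive1n /=.
rewrite (_ : (fun t : R => J (line s + t *: Z)) = fun t => J (line (s + t))); last first.
  by apply/funext => t; rewrite scalerDl addrA.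
have -> : (fun t => J (line (s + t)))^`()%classic =
    fun t => (fun u => J (line u))^`()%classic (s + t).
  by apply/funext => t; apply: (derive1_shift (fun u => J (line u))).
rewrite (derive1_shift (fun u => J (line u))^`()%classic) addr0.
have d1 : D1.[s] != 0 by rewrite hornerM mulf_neq0.
have [_ <-] := is_derive_ratfun N1 d1.
rewrite derive1E; apply: near_eq_derive.
by apply: filterS (horner_neq0_near ds) => v /derive1_J_line.
Qed.

End Quotient.

(** Stability is not closed by itself, but the contraction of one fixed power is uniform over the
    sublevel set and, being polynomial in the parameter for each [x], passes to the limit. *)
Lemma sublevel_line_closed a t : 0 < t -> Xm *m Z = 0 ->
  (forall s, 0 <= s < t -> sublevel a (line s)) -> sublevel a (line t).
Proof.
move=> t0 XZ hs.
have [c0 c0pos hc0] := posdef_coercive hQ.1 (sym_posdef_bform hQ).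
(* On the sublevel set [c0 * \tr Sigma <= J <= a]; the maximum with 1 meets the requirement of the
   power bound. *)
pose c := Num.max 1 (a / c0).
have c1 : 1 <= c by rewrite le_max lexx.
have [k hk] := exists_pow_lt1 c1.
have rho : spectral_radius (Xp *m line t) < 1.
  apply: (contracting_power_spectral_radius (K := k) hk) => x.
  have [p hp] := sqnorm_power_polynomial x k.
  rewrite hp; apply: (continuous_le_left t0 (@continuous_horner R p t)) => s st.
  have [[_ rho] Ja] := hs s st.
  rewrite -hp; apply: closed_loop_power_bound => //.
  rewrite le_max; apply/orP; right.
  by rewrite ler_pdivlMr // mulrC (le_trans (trace_Sigma_le hc0 rho)).
have [[XG _] _] := hs 0 (introT andP (conj (lexx 0) t0)).
have XGt : Xm *m line t = 1%:M.
  by rewrite mulmxDr -scalemxAr XZ scaler0 addr0 -XG scale0r addr0.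
split=> //.
have [N [D [hN hD]]] := line_quotient.
have dt := lyap_det_neq0 rho; rewrite hD in dt.
rewrite (J_line hN hD dt).
(* Stability at [t] makes the denominator nonzero, so the cost is continuous there and its bound
   passes to the limit too. *)
apply: (continuous_le_left t0 (continuous_ratfun dt)) => s st.
have [[_ rhos] Ja] := hs s st.
by rewrite -(J_line hN hD) // -hD lyap_det_neq0.
Qed.

End Line.

Lemma descent_step a l eta G : row_free Xm -> sublevel a G ->
  smoothness_constant Q Rw Xm Um Xp a l -> 0 < eta <= 1 / l ->
  let P := proj_null Xm *m gradJ G in
  sublevel a (G - eta *: P) /\
  J (G - eta *: P) <= J G - (eta - l * eta ^+ 2 / 2) * frobenius_norm P ^+ 2.
Proof.
move=> freeX sG [l0 hl] /andP[eta0 etal] P.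
have [P0|P0] := eqVneq (frobenius_norm P) 0.
  by rewrite (frobenius_norm_eq0 P0) scaler0 subr0 -(frobenius_norm_eq0 P0) P0 expr0n mulr0 subr0.
pose p := frobenius_norm P.
have p0 : 0 < p by rewrite lt_neqAle eq_sym P0 frobenius_norm_ge0.
(* The step is travelled at unit Frobenius speed, so the Hessian bound applies to [Z] without
   rescaling; the path has length [b = eta p]. *)
pose Z := - p^-1 *: P.
have Z1 : frobenius_norm Z = 1.
  by rewrite frobenius_normZ normrN gtr0_norm ?invr_gt0 // mulVf.
have XZ : Xm *m Z = 0.
  by rewrite /Z -scalemxAr /P mulmxA mul_proj_null // mul0mx scaler0.
have pathE : G - eta *: P = G + (eta * p) *: Z.
  by rewrite /Z scalerA mulrN mulfK // scaleNr.
pose b := eta * p.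
have b0 : 0 <= b by rewrite mulr_ge0 ?ltW.
(* This is [eta <= 1 / l]; it keeps the slope bound [- p + l t] strictly negative for [t < b]. *)
have lbp : l * b <= p.
  by rewrite mulrA ger_pMl // mulrC -ler_pdivlMr.
have [N [D [hN hD]]] := line_quotient G Z.
pose N1 := N^`() * D - N * D^`(); pose D1 := D * D.
have dG : lyap_det G != 0 by rewrite lyap_det_neq0 //; case: sG => -[].
have D0 : D.[0] != 0 by rewrite -hD scale0r addr0.
have slope0 : ratfun N1 D1 0 = - p.
  rewrite -(derive_J_line hN hD D0) derive_J //.
  rewrite /Z linearZ /= -scalemxAl mxtraceZ trace_proj_null // -/p.
  by rewrite expr2 mulrA mulNr mulVf // mulN1r.
(* Membership is required only up to [t], so the estimate is available while the path is still being
   extended. *)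
have taylor t : 0 <= t -> (forall s, 0 <= s <= t -> sublevel a (G + s *: Z)) ->
    ratfun N1 D1 t <= - p + l * t /\
    ratfun N D t <= J G - p * t + l * t ^+ 2 / 2.
  move=> t0 hs.
  have Dn s : 0 <= s <= t -> D.[s] != 0.
    by move=> /hs[[_ rho] _]; rewrite -hD lyap_det_neq0.
  have D1n s : 0 <= s <= t -> D1.[s] != 0.
    by move=> /Dn Ds; rewrite hornerM mulf_neq0.
  rewrite -[J G](_ : ratfun N D 0 = _); last first.
    by rewrite -(J_line hN hD D0) scale0r addr0.
  rewrite -mulNr -slope0.
  pose r2 := ratfun (N1^`() * D1 - N1 * D1^`()) (D1 * D1).
  apply: (@taylor2_le R (ratfun N D) (ratfun N1 D1) r2 t l _ _ _ t0) => s st.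
  - exact: is_derive_ratfun (Dn s st).
  - exact: is_derive_ratfun (D1n s st).
  - rewrite [leLHS](_ : _ = hessJ (G + s *: Z) Z); last first.
      by rewrite (hessJ_line hN hD (Dn s st)).
    apply: le_trans (ler_norm _) _; rewrite -lee_fin.
    apply: le_trans (hl _ (hs s st)).
    by apply: ereal_sup_ubound; exists Z.
have path : forall t, 0 <= t <= b -> sublevel a (G + t *: Z).
  apply: real_induction => t /andP[t0 tb] hs.
    (* The left-limit argument needs [t > 0]; at 0 the point is [G] itself. *)
    have [->|tn0] := eqVneq t 0; first by rewrite scale0r addr0.
    by apply: sublevel_line_closed XZ hs; rewrite lt_neqAle eq_sym tn0.
  have [st0 rt Jt] : [/\ feasible Xm Xp (G + t *: Z),
      spectral_radius (Xp *m (G + t *: Z)) < 1 & J (G + t *: Z) <= a].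
    by have [[? ?] ?] := hs t (introT andP (conj t0 (lexx t))).
  have [slope _] := taylor t t0 hs.
  (* Openness: the negative slope keeps the cost below its value at [t] just to the right, and
     stability persists nearby. *)
  have slopelt : ratfun N1 D1 t < 0.
    apply: le_lt_trans slope _; rewrite addrC subr_lt0.
    by apply: lt_le_trans lbp; rewrite ltr_pM2l.
  have Dt : D.[t] != 0 by rewrite -hD lyap_det_neq0.
  have [h1 h10 hdec] := derive_lt0_right (is_derive_ratfun N Dt) slopelt.
  have /nbhs_ballP[h2 /= h20 hball] := stable_near rt.
  exists (Num.min h1 h2); first by rewrite lt_min h10.
  move=> s /andP[ts]; rewrite -ltrBlDl lt_min !ltrBlDl => /andP[s1 s2].
  have rs : spectral_radius (Xp *m (G + s *: Z)) < 1.
    by apply: hball; rewrite /ball /= distrC gtr0_norm ?subr_gt0 // ltrBlDl.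
  split.
    by split=> //; rewrite mulmxDr -scalemxAr XZ scaler0 addr0; case: sG => -[].
  have Ds : D.[s] != 0 by rewrite -hD lyap_det_neq0.
  rewrite (J_line hN hD Ds) (le_trans _ Jt) // (J_line hN hD Dt).
  by apply: hdec; rewrite ts.
rewrite pathE -/b; have sb := path b (introT andP (conj b0 (lexx b))).
split=> //; have [_] := taylor b b0 path.
rewrite -(J_line hN hD); last by rewrite -hD lyap_det_neq0 //; case: sb => -[].
(* At [b = eta p] the bound [- p b + l b^2 / 2] equals [- (eta - l eta^2 / 2) p^2]. *)
by rewrite -/p /b => /le_trans; apply; rewrite le_eqVlt; apply/orP; left; apply/eqP; field.
Qed.

End Descent.

(** * Convergence rate and conclusion *)

Lemma sublinear_rate (R : realFieldType) (delta : nat -> R) (c eps : R) :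
  0 < c -> 0 < eps -> (forall k, delta k.+1 <= delta k) ->
  (forall k, 0 <= delta k -> delta k.+1 <= delta k - c * delta k ^+ 2) ->
  forall k, 1 / (c * eps) <= k%:R -> delta k <= eps.
Proof.
(* If [delta k > eps], monotonicity makes all earlier terms positive, so the step inequality and the
   reciprocals are available up to [k]. *)
move=> c0 eps0 dec step k hk; rewrite leNgt; apply/negP => dk.
have mono i j : delta (i + j)%N <= delta i.
  by elim: j => [|j IH]; rewrite ?addn0 // addnS (le_trans (dec _)).
have pos j : (j <= k)%N -> 0 < delta j.
  by move=> jk; rewrite (lt_trans eps0) // (lt_le_trans dk) // -(subnKC jk).
(* The reciprocal gains at least [c] per step, since [(1 + c d) (d - c d^2) = d - (c d)^2 d <=
   d]. *)
have inv j : (j <= k)%N -> c * j%:R < (delta j)^-1.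
  elim: j => [|j IH] jk; first by rewrite mulr0 invr_gt0 pos.
  have p0 := pos _ (ltnW jk); have p1 := pos _ jk.
  have h := step _ (ltW p0).
  have h1 : (delta j)^-1 + c <= (delta j.+1)^-1.
    rewrite -[leRHS]div1r ler_pdivlMr //.
    have -> : (delta j)^-1 + c = (1 + c * delta j) / delta j.
      by field; rewrite gt_eqF.
    rewrite mulrAC ler_pdivrMr // mul1r.
    have : (1 + c * delta j) * delta j.+1 <=
        (1 + c * delta j) * (delta j - c * delta j ^+ 2).
      by rewrite ler_wpM2l // addr_ge0 // mulr_ge0 // ltW.
    have -> : (1 + c * delta j) * (delta j - c * delta j ^+ 2) =
       delta j - (c * delta j) ^+ 2 * delta j by ring.
    have : 0 <= (c * delta j) ^+ 2 * delta j by rewrite mulr_ge0 ?sqr_ge0 // ltW.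
    lra.
  have := IH (ltnW jk); rewrite -natr1 mulrDr mulr1; lra.
have := inv k (leqnn k); rewrite ltNge => /negP; apply.
rewrite ler_pdivrMr ?mulr_gt0 // in hk.
rewrite -[leLHS]mul1r ler_pdivrMr ?pos //.
apply: le_trans hk _; rewrite mulrA [_ * c]mulrC.
by apply: ler_wpM2l (ltW dk); rewrite mulr_ge0 // ltW.
Qed.

Unset Implicit Arguments.

Theorem theorem1 (R : realType) (n m T : nat)
    (A : 'M[R]_n) (B : 'M[R]_(n, m)) (Q : 'M[R]_n) (Rw : 'M[R]_m)
    (Xm : 'M[R]_(n, T)) (Um : 'M[R]_(m, T)) (Xp : 'M[R]_(n, T))
    (hAB : controllable A B)
    (hQ : sym_posdef Q) (hRw : sym_posdef Rw)
    (hdata : Xp = A *m Xm + B *m Um)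
    (hrank : \rank (col_mx Um Xm) = (m + n)%N)
    (G : nat -> 'M[R]_(T, n)) (mu0 l0 eta : R)
    (hG0 : feasible Xm Xp (G 0%N))
    (hmu0 : gradient_dominance_constant Q Rw Xm Um Xp (J Q Rw Um Xp (G 0%N)) mu0)
    (hl0 : smoothness_constant Q Rw Xm Um Xp (J Q Rw Um Xp (G 0%N)) l0)
    (heta : 0 < eta <= 1 / l0)
    (hG : forall k : nat,
       G k.+1 = G k - eta *: (proj_null Xm *m gradJ Q Rw Um Xp (G k))) :
  (forall k : nat, sublevel Q Rw Xm Um Xp (J Q Rw Um Xp (G 0%N)) (G k)) /\
  (forall (eps : R) (k : nat), 0 < eps ->
     2 * mu0 ^+ 2 / (eps * (2 * eta - l0 * eta ^+ 2)) <= k%:R ->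
     J Q Rw Um Xp (G k) - Jstar Q Rw Xm Um Xp <= eps).
Proof.
(* The stacked matrix has rank at most [m + \rank Xm], which forces [\rank Xm = n]. *)
have freeX : row_free Xm.
  rewrite /row_free eqn_leq rank_leq_row /= -(leq_add2l m) -hrank.
  by rewrite -addsmxE (leq_trans (mxrank_adds_leqif _ _).1) // leq_add2r rank_leq_row.
set a := J Q Rw Um Xp (G 0%N) in hmu0 hl0 *.
have sub k : sublevel Q Rw Xm Um Xp a (G k).
  elim: k => [|k IH]; first by split.
  by have [] := descent_step hQ hRw freeX IH hl0 heta; rewrite -hG.
split=> // eps k eps0 hk.
have [mu_gt0 hdom] := hmu0; have [l_gt0 _] := hl0; have /andP[eta0 etal] := heta.
have leta : l0 * eta <= 1 by rewrite mulrC -ler_pdivlMr.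
(* Half of the factor [2 eta - l0 eta^2] in the rate; it is at least [eta / 2] because
   [l0 eta <= 1]. *)
pose gamma := eta - l0 * eta ^+ 2 / 2.
have gamma0 : 0 < gamma.
  have : l0 * eta ^+ 2 <= eta by rewrite expr2 mulrA ger_pMl.
  rewrite /gamma; lra.
have step j : J Q Rw Um Xp (G j.+1) <= J Q Rw Um Xp (G j) -
    gamma * frobenius_norm (proj_null Xm *m gradJ Q Rw Um Xp (G j)) ^+ 2.
  by have [_] := descent_step hQ hRw freeX (sub j) hl0 heta; rewrite -hG.
set Js := Jstar _ _ _ _ _ in hdom *.
pose delta j := J Q Rw Um Xp (G j) - Js.
apply: (@sublinear_rate R delta (gamma / mu0 ^+ 2) eps) => //.
- by rewrite divr_gt0 // exprn_gt0.
- move=> j; rewrite lerD2r (le_trans (step j)) // gerBl.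
  by rewrite mulr_ge0 ?sqr_ge0 // ltW.
(* Gradient dominance may be squared because [delta j >= 0]; this produces the constant
   [gamma / mu0^2]. *)
- move=> j dj; rewrite /delta addrAC lerD2r (le_trans (step j)) // lerD2l lerN2.
  rewrite mulrAC -mulrA ler_pM2l // ler_pdivrMr ?exprn_gt0 // mulrC -exprMn.
  rewrite ler_sqr ?nnegrE ?mulr_ge0 ?frobenius_norm_ge0 ?(ltW mu_gt0) //.
  apply: le_trans (hdom _ (sub j)) _.
  by rewrite ler_pM2l // spectral_norm_le_frobenius.
- apply: le_trans hk; rewrite le_eqVlt; apply/orP; left; apply/eqP.
  have -> : 2 * eta - l0 * eta ^+ 2 = 2 * gamma by rewrite /gamma; field.
  by field; rewrite !gt_eqF.
Qed.
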